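(* For every finite set $A=\{a_1<a_2<\cdots<a_k\}$ of positive integers there exists a bijection $\psi:\mathcal{BP}(A)\to c\mathcal{BP}(A)$ that preserves the box-neighbor-set, i.e. the box-neighbor-set of $\psi(w)$ equals the box-neighbor-set of $w$ for every $w\in\mathcal{BP}(A)$.
   Context: Let $\Box$ be an extra symbol. A box-permutation on $A$ is a word $w$ over $A\cup\{\Box\}$ in which each element of $A$ appears exactly once, such that: if $\Box$ does not occur then $w=a_1a_2\cdots a_k$; otherwise the (box-free) segment before the first box and the segment after the last box each have length at least one and are increasing, and every segment between two successive boxes has length at least two and is increasing. $\mathcal{BP}(A)$ is the set of box-permutations on $A$ (e.g. $\mathcal{BP}([3])=\{123,1\Box23,2\Box13,3\Box12,12\Box3,13\Box2,23\Box1\}$). A cycle $C=(c_1\cdots c_{2\ell+1})$ of odd length, considered up to cyclic rotation, with entries in $A\cup\{\Box\}$ and each element of $A$ at most once, is an odd box-cycle (resp. reverse odd box-cycle) on $A$ if either $C=(a)$ for a single $a\in A$, or $\ell\ge1$, $C$ contains at least one box, no two boxes are cyclically adjacent, and every maximal cyclically consecutive run of integers in $C$ has length at least two and is increasing in the clockwise (i.e. left-to-right cyclic) direction (resp. in the counterclockwise direction). A cyclic box-permutation on $A$ is a set of cycles, each an odd box-cycle or a reverse odd box-cycle on $A$, such that every element of $A$ appears in exactly one of them; $c\mathcal{BP}(A)$ is the set of these (e.g. $c\mathcal{BP}([3])=\{(1)(2)(3),(1)(23\Box),(1)(32\Box),(2)(13\Box),(2)(31\Box),(3)(12\Box),(3)(21\Box)\}$).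 The box-neighbor-set of a box-permutation (resp. cyclic box-permutation) is the set of all 2-subsets $\{a,b\}$ such that $a,b$ are the two neighbors (resp. two cyclic neighbors) of some box. *)

(* Defs.v *)
From mathcomp Require Import all_boot.
From mathcomp Require Import finmap.
Set Implicit Arguments. Unset Strict Implicit. Unset Printing Implicit Defensive.
Local Open Scope fset_scope.

(* Words over A ∪ {□}: the box □ is [None], an integer a is [Some a]. *)
Notation word := (seq (option nat)).

(* the maximal box-free segments of a word, separated by the boxes;
   a word with m boxes has exactly m+1 (possibly empty) segments. *)
Fixpoint segs (w : word) : seq (seq nat) :=
  match w with
  | [::] => [:: [::]]
  | None :: w' => [::] :: segs w'
  | Some a :: w' =>
      match segs w' with
      | s :: ss => (a :: s) :: ss
      | [::] => [:: [:: a]]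
      end
  end.

Definition entries_in (A : {fset nat}) (w : word) : bool :=
  all (fun x => if x is Some a then a \in A else true) w.

Definition ints (w : word) : seq nat := pmap id w.

Definition is_BP (A : {fset nat}) (w : word) : bool :=
  let ss := segs w in
  [&& entries_in A w,
      all (fun a => count_mem (Some a) w == 1) A,
      all (sorted ltn) ss &
      (1 < size ss) ==>
        [&& 0 < size (head [::] ss), 0 < size (last [::] ss) &
            all (fun s => 1 < size s) (drop 1 (take (size ss).-1 ss))]].

Definition nbr2 (x y : option nat) : option {fset nat} :=
  if (x, y) is (Some a, Some b) then Some [fset a; b] else None.

Definition box_nbrs (w : word) : {fset {fset nat}} :=
  [fset X | X in pmap (fun i => if (nth None w i == None) && (0 < i)
                                then nbr2 (nth None w i.-1) (nth None w i.+1)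
                                else None) (iota 0 (size w))].

(* A cycle (c_0 ... c_{n-1}) is represented by a sequence; its entries are
   cyclically consecutive (c_{n-1} is followed by c_0). *)
Definition cyc_box_nbrs (c : word) : seq {fset nat} :=
  let n := size c in
  pmap (fun i => if nth None c i == None
                 then nbr2 (nth None c ((i + n).-1 %% n)) (nth None c (i.+1 %% n))
                 else None) (iota 0 n).

Definition boxes_nonadj (c : word) : bool :=
  all (fun i => (nth None c i != None) || (nth None c (i.+1 %% size c) != None))
      (iota 0 (size c)).

(* maximal cyclically consecutive runs of integers of a cycle containing a
   box: rotate so that a box comes first, drop it, and cut at the boxes *)
Definition runs (c : word) : seq (seq nat) :=
  segs (behead (rot (index None c) c)).

(* odd box-cycles w.r.t. the order r on runs:
   r = ltn  : runs increasing clockwise (odd box-cycle),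
   r = gtn  : runs increasing counterclockwise (reverse odd box-cycle). *)
Definition box_cycle_gen (r : rel nat) (A : {fset nat}) (c : word) : bool :=
  [&& entries_in A c, uniq (ints c), odd (size c) &
      (if c is [:: Some _] then true else false) ||
      [&& 1 < size c, None \in c, boxes_nonadj c &
          all (fun s => (1 < size s) && sorted r s) (runs c)]].

Definition odd_box_cycle A c := box_cycle_gen ltn A c.
Definition rev_odd_box_cycle A c := box_cycle_gen (fun x y => y < x) A c.

(* A cycle is considered up to rotation; we represent each cycle by its
   unique rotation starting with its smallest integer entry. *)
Definition canonical_rot (c : word) : bool :=
  head None c == ohead (sort leq (ints c)).

Definition is_cBP (A : {fset nat}) (S : {fset word}) : bool :=
  [&& all (fun c => canonical_rot c && (odd_box_cycle A c || rev_odd_box_cycle A c)) S &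
      all (fun a => count (fun c => Some a \in c) S == 1) A].

Definition cbox_nbrs (S : {fset word}) : {fset {fset nat}} :=
  [fset X | X in flatten [seq cyc_box_nbrs c | c <- S]].

(* Main.v *)
(* Induct on the size of [A], removing the cycle through n = min A.  Besides
   the fixed point (n), the cycles through n are (n R □) and its reverse
   (n □ rev R), where R has odd length and R □ n is the beginning of a
   box-permutation.  So it suffices to match the words w on [A] with the pairs
   (cycle c through n, word p on the other letters).
   - w = n p with p not starting with a box corresponds to ((n), p).
   - w = R □ n p with |R| odd corresponds to ((n R □), p).
   - w = R □ n p with |R| even: the pairs (R, p) carry an involution [tog] that
     keeps the box neighbors and the last letter of R and flips the parity of
     |R|; it moves the smaller of the two first letters to the front of the
     other word.  With (R', p') the image of (R, p), w corresponds to
     ((n □ rev R'), p').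
   - The involution is undefined only if R is a single letter x that is smaller
     than all letters in the first segment of p; then w = n □ x p corresponds
     to ((n □ x), p). *)
Require Import Defs.
From mathcomp Require Import all_boot.
From mathcomp Require Import finmap.
From mathcomp Require Import zify.
Set Implicit Arguments. Unset Strict Implicit. Unset Printing Implicit Defensive.
Local Open Scope fset_scope.

(** * Segments and the local shape of box-permutations *)

(* The last segment may be a single letter following a box iff [b] holds. *)
Fixpoint chain (b : bool) (w : word) : bool :=
  match w with
  | [:: Some _] => true
  | Some a :: ((Some c :: _) as w') => (a < c) && chain b w'
  | Some _ :: None :: ((Some _ :: t) as w') =>
      (if t is x :: _ then isSome x else b) && chain b w'
  | _ => false
  end.

Definition bp (w : word) : bool := (w == [::]) || chain true w.

(** The recursion of [chain] skips two entries at a box and one elsewhere, so both tails need a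
    hypothesis. *)
Lemma word_ind2 (P : word -> Prop) :
  P [::] -> (forall x, P [:: x]) ->
  (forall x y w, P w -> P (y :: w) -> P [:: x, y & w]) -> forall w, P w.
Proof.
move=> P0 P1 P2 w; suff: P w /\ forall x, P (x :: w) by case.
elim: w => [|y w [IH1 IH2]]; first by split.
by split=> [|x]; [apply: IH2 | apply: P2].
Qed.

Lemma segs_neq0 w : segs w != [::].
Proof. by case: w => [|[a|] w] //=; case: (segs w). Qed.

Lemma segs_cons_Some a w :
  segs (Some a :: w) = (a :: head [::] (segs w)) :: behead (segs w).
Proof. by rewrite /=; case: (segs w) (segs_neq0 w). Qed.

Lemma segs_cat_None u v : segs (u ++ None :: v) = segs u ++ segs v.
Proof.
elim: u => [|[a|] u IH] //; last by rewrite /= IH.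
rewrite cat_cons !segs_cons_Some IH; by case: (segs u) (segs_neq0 u).
Qed.

Lemma segs_rcons_Some w a :
  segs (rcons w (Some a)) =
  rcons (take (size (segs w)).-1 (segs w)) (rcons (last [::] (segs w)) a).
Proof.
elim: w => [|[b|] w IH] //.
  rewrite rcons_cons !segs_cons_Some IH.
  by case: (segs w) (segs_neq0 w) => [|s [|s' ss]].
by rewrite /= IH; case: (segs w) (segs_neq0 w).
Qed.

Lemma segs_rev w : segs (rev w) = rev (map rev (segs w)).
Proof.
elim: w => [|[a|] w IH] //.
  rewrite rev_cons segs_rcons_Some IH segs_cons_Some.
  case: (segs w) (segs_neq0 w) => [|s ss] //= _.
  by rewrite !rev_cons size_rcons last_rcons -[in take _ _]cats1 take_size_cat.
by rewrite rev_cons -cats1 segs_cat_None IH /= rev_cons cats1.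
Qed.

(** Here [~~ b] is read as 0 or 1: the last segment needs length 1 if [b] holds and 2 otherwise. *)
Definition tail_ok (b : bool) (ss : seq (seq nat)) : bool :=
  if ss is s :: ss'
  then all (fun s => 1 < size s) (belast s ss') && (~~ b < size (last s ss'))
  else true.

Lemma chain_segs b w :
  chain b w = [&& all (sorted ltn) (segs w), head [::] (segs w) != [::] &
                  tail_ok b (behead (segs w))].
Proof.
elim/word_ind2: w => [|[a|] //|[a|] [c|] w IHw IH] //.
- rewrite [LHS]/= -/(chain b (Some c :: w)) IH !segs_cons_Some /=.
  by case: ltnP => //= _; rewrite ?andbF.
- case: w IHw {IH} => [|[c|] w] IHw /=; rewrite ?andbF //.
  rewrite -/(chain b (Some c :: w)) IHw !segs_cons_Some [behead _]/= [head _
    _]/=.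
  case: w {IHw} => [|[d|] w] /=.
  + by case: b.
  + by case: (segs w) (segs_neq0 w) => [|s [|s' ss]] //= _; case: b;
      rewrite ?andbT.
  + by case: (segs w) (segs_neq0 w) => [|s ss] //= _; rewrite !andbF.
- by rewrite /=; case: (segs w) (segs_neq0 w) => [|s ss] //=; rewrite andbF.
- by rewrite /= andbF.
Qed.
Lemma mem_ints a w : (a \in ints w) = (Some a \in w).
Proof. by rewrite /ints mem_pmap map_id. Qed.

Lemma count_ints a w : count_mem a (ints w) = count_mem (Some a) w.
Proof. by elim: w => [|[b|] w IH] //=; rewrite IH. Qed.

Lemma entries_inP (A : {fset nat}) w :
  reflect (forall a, Some a \in w -> a \in A) (entries_in A w).
Proof.
apply: (iffP allP) => [H a /H //|H [a|] // /H //].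
Qed.

(** A nonempty word with a single segment has no box, so its only segment is nonempty and the extra
    demand of [chain] on the first segment costs nothing. *)
Lemma is_BPE A w : is_BP A w = perm_eq (ints w) A && bp w.
Proof.
rewrite /is_BP /= andbA; congr (_ && _).
  apply/andP/allP => [[/entries_inP eA /allP cA] a|pA].
    rewrite mem_cat /= => aA; have {}aA : a \in A.
      by case/orP: aA => //; rewrite mem_ints => /eA.
    by rewrite count_ints (eqP (cA _ aA)) (count_uniq_mem _ (fset_uniq A)) aA.
  have {}pA : perm_eq (ints w) A by apply/allP.
  split; first by apply/entries_inP => a; rewrite -mem_ints (perm_mem pA).
  apply/allP => a aA; rewrite -count_ints (permP pA).
  by rewrite (count_uniq_mem _ (fset_uniq A)) aA.
rewrite /bp chain_segs; case: w => [|x w] //; rewrite [_ == _]/= orFb.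
case E : (segs _) (segs_neq0 (x :: w)) => [|s ss] // _.
rewrite [behead _]/= [head _ _]/=; case: ss E => [|s' ss] E.
  rewrite /= !andbT; case: (sorted _ _) => //=; case: x E => //=.
    by move=> a; case: (segs w) => [|? ?] [<-].
  by case=> _ E; move: (segs_neq0 w); rewrite E.
case/lastP: ss E => [|ss s''] E; rewrite /= ?drop0 ?andbT ?lt0n ?size_eq0 //.
congr (_ && (_ && _)); rewrite size_rcons last_rcons belast_rcons.
by rewrite -cats1 -cat_cons take_size_cat //= andbC.
Qed.

Lemma flatten_segs w : flatten (segs w) = ints w.
Proof.
by elim: w => [|[a|] w IH] //; rewrite segs_cons_Some /= -IH; case: (segs w).
Qed.

(** A smaller letter in front lengthens the first segment and keeps it increasing, so its lower
    bound 1 becomes the bound 2 of all the others. This makes [chain false] the run condition for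
    cycles through [n]. *)
Lemma chain_extend n R : R != [::] -> {in ints R, forall a, n < a} ->
  chain false R = all (fun s => (1 < size s) && sorted ltn s) (segs (Some n ::
    R)).
Proof.
move=> R0; rewrite chain_segs segs_cons_Some -flatten_segs.
case: (segs R) (segs_neq0 R) => [|r rs] //= _ lt_n.
rewrite path_sortedE; last exact: ltn_trans.
have -> : all (ltn n) r.
  by apply/allP => a ar; apply: lt_n; rewrite mem_cat ar.
rewrite ltnS lt0n size_eq0 /= -!andbA; case: (sorted ltn r);
  rewrite /= ?andbF //.
rewrite andbCA; congr (_ && _); rewrite all_predI andbC; congr (_ && _).
case: rs {lt_n} => [|s rs] //.
by rewrite [in RHS](lastI s rs) all_rcons andbC.
Qed.

(** * The parity-reversing involution *)

Lemma chain_head b w : chain b w -> exists a t, w = Some a :: t.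
Proof. by case: w => [|[a|] w] // _; exists a, w. Qed.

Lemma chain_last b w : chain b w -> exists t a, w = rcons t (Some a).
Proof.
elim/word_ind2: w => [|[a|]|[a|] y w IHw IH] //; first by exists [::], a.
case: y IH => [c|] IH.
  by case/andP => _ /IH [t [d ->]]; exists (Some a :: t), d.
case: w IHw {IH} => [|[c|] w] // IH /andP[_ /IH [t [d ->]]].
by exists [:: Some a, None & t], d.
Qed.

Lemma bpP p : bp p -> p = [::] \/ exists a t, p = Some a :: t /\ chain true p.
Proof. by case: p => [|[a|] p] //; [left | right; exists a, p]. Qed.

(** The box closes the last segment of [R], hence [chain false]. Being minimal, [n] extends the
    first segment of [p] freely; a box at the start of [p] would leave [n] alone between two
    boxes. *)
Lemma chain_cat_min n R p : {in ints p, forall a, n < a} -> R != [::] ->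
  chain true (R ++ [:: None, Some n & p]) = chain false R && bp p.
Proof.
move=> lt_n.
elim/word_ind2: R => [|[a|]|[a|] y w IHw IH] // _.
  case: p lt_n => [|[c|] p] // lt_n; rewrite /bp /=.
  by rewrite lt_n // mem_ints mem_head.
case: y IH => [c|] IH.
  by rewrite !cat_cons in IH *; rewrite -[RHS]andbA -IH.
case: w IHw {IH} => [|[c|] w] // IHw.
rewrite !cat_cons in IHw *; rewrite -[RHS]andbA -IHw //=.
by case: w {IHw}.
Qed.

(* [mv s d] moves the first letter of [s] to [d], or, if that letter is a
   segment by itself, it moves the first box with its two neighbors, which get
   swapped so that both segments remain increasing. *)
Definition mv (s d : word) : word * word :=
  match s with
  | Some z :: None :: Some a :: v => (v, [:: Some a, None, Some z & d])
  | z :: v => (v, z :: d)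
  | [::] => ([::], d)
  end.

Definition pushable (R p : word) : bool :=
  if (p, R) is (Some z :: _, Some y :: _) then z < y else false.

(** A single-letter [R] cannot give its letter away: it would become empty and lose its last
    letter. *)
Definition stuck (R p : word) : bool := (size R == 1) && ~~ pushable R p.

Definition tog (R p : word) : word * word :=
  if pushable R p then ((mv p R).2, (mv p R).1) else mv R p.

Definition wf (R p : word) : bool :=
  [&& chain false R, bp p & uniq (ints (R ++ p))].

(* Here [p] and [e] are the letters before and after the word. *)
Fixpoint nb (p : option nat) (w : word) (e : option nat) : seq {fset nat} :=
  match w with
  | [::] => [::]
  | x :: w' => seq_of_opt (if x == None then nbr2 p (head e w') else None)
               ++ nb x w' e
  end.

Lemma nb_box x y w e :
  nb x [:: None, y & w] e = seq_of_opt (nbr2 x y) ++ nb None (y :: w) e.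
Proof. by []. Qed.

Lemma nb_Some x a w e : nb x (Some a :: w) e = nb (Some a) w e.
Proof. by []. Qed.


(** As [mv] moves one entry or three, the parity flips; as it acts at the fronts, the last letter of
    [R] stays. Box neighbors are compared for both words together because a moved box takes its pair
    along. *)
Variant tog_spec (R p : word) (o : word * word) : Prop :=
  TogSpec R1 p1 of o = (R1, p1) & wf R1 p1 & ~~ stuck R1 p1 & tog R1 p1 = (R, p)
   & odd (size R1) = ~~ odd (size R) & perm_eq (R1 ++ p1) (R ++ p)
   & last None R1 = last None R
   & nb None R1 None ++ nb None p1 None =i nb None R None ++ nb None p None.

Lemma perm_mv s d : perm_eq ((mv s d).2 ++ (mv s d).1) (d ++ s).
Proof.
case: s => [|[z|] [|[a|] [|[c|] s]]] //=; 
by apply/permP => P; rewrite /= !count_cat /= ?count_cat /=; lia.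
Qed.

Lemma nbr2C x y : nbr2 x y = nbr2 y x.
Proof. by case: x y => [x|] [y|] //; congr Some; apply: fsetUC. Qed.


Lemma chain1 b a : chain b [:: Some a]. Proof. by []. Qed.

Lemma chainSS b a c t :
  chain b [:: Some a, Some c & t] = (a < c) && chain b (Some c :: t).
Proof. by []. Qed.

Lemma chainSNS b a c t :
  chain b [:: Some a, None, Some c & t] =
  (if t is x :: _ then isSome x else b) && chain b (Some c :: t).
Proof. by []. Qed.

Lemma bp_cons x t : bp (x :: t) = chain true (x :: t). Proof. by []. Qed.

Arguments chain : simpl never.
Definition chainE := (chain1, chainSS, chainSNS, bp_cons).


(** The new first letter of [R] is smaller than the new first letter of [p], if any, so the next
    toggle pops the same entries back. *)
Lemma mv_pushP R p : wf R p -> pushable R p ->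
  tog_spec R p ((mv p R).2, (mv p R).1).
Proof.
move=> /and3P[cR bp_p uRp] pu.
have pm := perm_mv p R.
have: uniq (ints ((mv p R).2 ++ (mv p R).1)).
  by rewrite (perm_uniq (perm_pmap _ pm)).
move: pu pm cR bp_p uRp.
case: p => // -[z|//] p; case: R => // -[y|//] R; rewrite {1}/pushable => zy.
case: p => [|[a|] p]; last case: p => [|[c|] p] //.
all: rewrite [mv _ _]/= /fst /snd => pm cR bp_p uRp u.
- econstructor; [reflexivity | | | | | | | ] => //.
  by rewrite /wf !chainE zy cR.
- move: bp_p; rewrite bp_cons chainSS => /andP[za cp].
  econstructor; [reflexivity | | | | | | | ] => //.
  + by rewrite /wf !chainE zy cR cp.
  + by rewrite /tog /pushable ltnNge (ltnW za).
- move: bp_p; rewrite bp_cons chainSNS => /andP[hp cp].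
  have bp_p : bp p by case: p hp cp {pm uRp u} => [|[a|] p] //=;
    rewrite chainE => _ /andP[].
  (* The segment that [c] started continues in [p], so [c] is below the new first letter of [p]. *)
  have hc : ~~ pushable [:: Some c, None, Some z, Some y & R] p.
    case: p hp cp {pm uRp u bp_p} => [|[a|] p] //=;
      rewrite chainE => _ /andP[ca _].
    by rewrite /pushable -leqNgt ltnW.
  econstructor; [reflexivity | | | | | | | ] => //.
  + by rewrite /wf chainSNS chainSS zy cR bp_p.
  + by rewrite /tog /= (negbTE hc).
  + by rewrite /= negbK.
  (* The box carries the unordered pair of [z] and [c] from [p] to [R]. *)
  + move=> X; rewrite !(nb_Some, nb_box) (nbr2C (Some z));
      case: p hp {cp bp_p uRp u hc pm}.
      by rewrite !cats0 !mem_cat orbC.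
    by move=> [a|] p // _; rewrite !nb_Some !mem_cat orbCA orbA.
Qed.

(** After popping, [p] has the smaller first letter, so the new pair is pushable, hence not stuck,
    and the next toggle pushes. *)
Lemma mv_popP R p : wf R p -> ~~ pushable R p -> size R != 1 ->
  tog_spec R p (mv R p).
Proof.
move=> /and3P[cR bp_p uRp] npu R1.
have pm : perm_eq ((mv R p).1 ++ (mv R p).2) (R ++ p).
  by rewrite perm_catC (perm_trans (perm_mv R p)) // perm_catC.
have: uniq (ints ((mv R p).1 ++ (mv R p).2)).
  by rewrite (perm_uniq (perm_pmap _ pm)).
(* Failing to be pushable only gives [y <= b]; equality is excluded because the letters are
   distinct. *)
have lt_p y R' b p' : R = Some y :: R' -> p = Some b :: p' -> y < b.
  move=> eR ep; move: npu uRp; rewrite eR ep /pushable -leqNgt leq_eqVlt.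
  case/predU1P => // ->; rewrite /= mem_ints mem_cat mem_head orbT.
  by [].
move: npu pm cR bp_p uRp lt_p R1.
case: R => // -[y|//] R.
case: R => [//|[a|] R]; last case: R => [|[c|] R] //.
all: rewrite [mv _ _]/= /fst /snd => npu pm cR bp_p uRp lt_p _ u.
- move: cR; rewrite chainSS => /andP[ya cR].
  econstructor; [reflexivity | | | | | | | ] => //.
  + rewrite /wf cR u.
    case/bpP: bp_p lt_p => [->|[b [t [-> cp]]]] lt_p; rewrite !chainE //.
    by rewrite (lt_p y (Some a :: R) b t) ?cp.
  + by rewrite /stuck /pushable ya andbF.
  + rewrite /tog /pushable ya /=.
    by case/bpP: bp_p => [->|[b [t [-> cp]]]].
  + by rewrite /= negbK.
  + move=> X; rewrite /= !mem_cat; congr (_ || _).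
    by case/bpP: bp_p => [->|[b [t [-> cp]]]].
- move: cR; rewrite chainSNS => /andP[hR cR].
  (* [chain false] forbids a single-letter last segment after a box, so a letter [a] follows [c],
     and [R] keeps its last letter. *)
  case: R npu pm hR cR uRp lt_p u => [|[a|] R] // npu pm _ cR uRp lt_p u.
  move: (cR); rewrite chainSS => /andP[ca cR'].
  econstructor; [reflexivity | | | | | | | ] => //.
  + rewrite /wf cR' u.
    case/bpP: bp_p lt_p => [->|[b [t [-> cp]]]] lt_p; rewrite !chainE //.
    by rewrite (lt_p y (None :: Some c :: Some a :: R) b t) //= cp.
  + by rewrite /stuck /pushable ca andbF.
  + by rewrite /tog /pushable ca /=.
  + by rewrite /= !negbK.
  + move=> X; rewrite !(nb_Some, nb_box) (nbr2C (Some y)) !(mem_cat, inE) orbCA.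
    rewrite orbA; congr (_ || _).
    by case/bpP: bp_p => [->|[b [t [-> cp]]]].
Qed.

Lemma togP R p : wf R p -> ~~ stuck R p -> tog_spec R p (tog R p).
Proof.
rewrite /stuck /tog => wfRp; case: ifPn => [pu _|npu]; first exact: mv_pushP.
by rewrite andbT; apply: mv_popP.
Qed.

(** * Box neighbors *)

Lemma nb_cat p u v e : nb p (u ++ v) e = nb p u (head e v) ++ nb (last p u) v e.
Proof.
by elim: u p => [|x u IH] p //=; rewrite IH catA; case: u {IH}.
Qed.

Lemma mem_nb_rev p u e : nb e (rev u) p =i nb p u e.
Proof.
elim: u p e => [|x u IH] p e X //=.
rewrite rev_cons -cats1 nb_cat [nb _ [:: x] _]/= cats0 !mem_cat IH orbC;
  congr (_ || _).
case: x => //=; rewrite nbr2C; congr (_ \in seq_of_opt (nbr2 _ _)).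
by case: u {IH} => [|y u] //; rewrite rev_cons last_rcons.
Qed.

(** Prepending [p] makes entry [i] the left neighbor of position [i]; appending [e] supplies the
    right neighbor of the last position. *)
Lemma nb_pmap p w e :
  pmap (fun i => if nth None w i == None
                 then nbr2 (nth None (p :: w) i) (nth None (rcons w e) i.+1)
                 else None) (iota 0 (size w)) = nb p w e.
Proof.
elim: w p => [|x w IH] p //.
rewrite [iota _ _]/= -[1]addn0 iotaDl /= -IH.
have -> : nth None (rcons w e) 0 = head e w by case: w {IH}.
rewrite -[X in X = _]cat0s.
have -> : forall (f : nat -> option {fset nat}) s, 
  pmap f (map (addn 1) s) = pmap (fun i => f i.+1) s.
  by move=> f; elim=> //= i s ->.
by case: (if _ then _ else _).
Qed.

Lemma mem_box_nbrs w : box_nbrs w =i nb None w None.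
Proof.
move=> X; rewrite -nb_pmap !inE /=; congr (X \in _).
apply: eq_pmap => i.
have -> : nth None (rcons w None) i.+1 = nth None w i.+1.
  by rewrite nth_rcons if_same; case: ltnP => // /(nth_default None).
(* At position 0 the left neighbor is [None], so [nbr2] gives nothing, in agreement with the guard
   [0 < i]. *)
by case: i => [|i]; rewrite /= ?andbF ?andbT // if_same.
Qed.

(** Cutting the cycle at its integer entry [a] makes [a] the letter before and after the rest. *)
Lemma cyc_box_nbrsE a t :
  cyc_box_nbrs (Some a :: t) = nb (Some a) t (Some a).
Proof.
rewrite /cyc_box_nbrs -[RHS]/(nb None (Some a :: t) (Some a)) -nb_pmap.
apply: eq_in_pmap => i; rewrite mem_iota add0n => /= hi.
case: i hi => // i; rewrite ltnS => hi.
rewrite [_.-1](_ : _ = (i + (size t).+1)%N) //.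
rewrite modnDr modn_small; last exact: leqW.
congr (if _ then nbr2 _ _ else None).
case: (ltngtP i.+1 (size t)) hi => // [hi|e] _.
  by rewrite modn_small // nth_rcons hi.
by rewrite e modnn nth_rcons ltnn eqxx.
Qed.

(** * Cycles through the minimum *)

Definition good (A : {fset nat}) (c : word) : bool :=
  canonical_rot c && (odd_box_cycle A c || rev_odd_box_cycle A c).

Definition nonadj (x y : option nat) : bool := (x != None) || (y != None).

Definition good_run (r : rel nat) (s : seq nat) : bool :=
  (1 < size s) && sorted r s.

Lemma canonical_rotE n c : Some n \in c -> {in ints c, forall a, n <= a} ->
  canonical_rot c = (head None c == Some n).
Proof.
rewrite -mem_ints => nc le_n; rewrite /canonical_rot; congr (_ == _).
have := sort_sorted leq_total (ints c).
have : n \in sort leq (ints c) by rewrite mem_sort.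
have : {in sort leq (ints c), forall a, n <= a} by move=> a; rewrite mem_sort;
  apply: le_n.
case: (sort leq (ints c)) => //= b s le_ns; rewrite inE => /predU1P[-> //|ns].
rewrite path_sortedE => [/andP[/allP bs _]|]; last exact: leq_trans.
by congr Some; apply/eqP; rewrite eqn_leq bs // le_ns ?mem_head.
Qed.

Lemma box_split c : None \in c ->
  exists u v, c = u ++ None :: v /\ (None : option nat) \notin u.
Proof.
elim: c => [|[a|] c IH] //; last by exists [::], c.
by rewrite inE => /= /IH [u [v [-> uN]]]; exists (Some a :: u), v.
Qed.

Lemma runs_cat u v : None \notin u -> runs (u ++ None :: v) = segs (v ++ u).
Proof. by move=> uN; rewrite /runs index_pivot // rot_size_cat. Qed.

(** [runs] starts after the first box, so it lists the segments of [c] in a rotated order, which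
    [all] does not see. *)
Lemma all_runs_rcons c (P : pred (seq nat)) :
  all P (runs (rcons c None)) = all P (segs c).
Proof.
have [cN|cN] := boolP (None \in c); last by rewrite -cats1 runs_cat.
have [u [v [-> uN]]] := box_split cN.
by rewrite rcons_cat rcons_cons runs_cat // cat_rcons !segs_cat_None !all_cat
  andbC.
Qed.

Lemma runs_box n v : runs [:: Some n, None & v] = segs (rcons v (Some n)).
Proof. by rewrite (@runs_cat [:: Some n]) ?inE // cats1. Qed.

Lemma boxes_nonadj_path n t : path nonadj (Some n) t -> boxes_nonadj (Some n ::
  t).
Proof.
move/(pathP None) => Ht; apply/allP => i; rewrite mem_iota add0n => /= hi.
have := Ht i; move: hi; rewrite ltnS leq_eqVlt => /predU1P[->|hi].
  by rewrite modnn /= orbT.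
by rewrite modn_small // => /(_ hi).
Qed.

Lemma chain_nonadj b w : chain b w -> sorted nonadj w.
Proof.
elim/word_ind2: w => [|[a|]|[a|] [c|] w IHw IH] //.
  by rewrite chainSS => /andP[_ /IH].
by case: w IHw {IH} => [|[c|] w] // IHw; rewrite chainSNS => /andP[_ /IHw].
Qed.

Lemma segs_adj (r : rel nat) x a b y :
  all (sorted r) (segs (x ++ [:: Some a, Some b & y])) -> r a b.
Proof.
elim: x => [|[c|] x IH] //.
  by rewrite cat0s !segs_cons_Some /= => /andP[/andP[]].
rewrite cat_cons segs_cons_Some => H; apply: IH; move: H => /=.
by case: (segs _) => //= s ss /andP[/path_sorted -> ->].
Qed.

(** Read counterclockwise from [n], the cycle is [n], then [rev v], then the box, and its runs
    increase. *)
Lemma chain_gt_runs n v : v != [::] -> {in ints v, forall a, n < a} ->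
  all (good_run (fun x y => y < x)) (runs [:: Some n, None & v]) =
  chain false (rev v).
Proof.
move=> v0 lt_n; rewrite runs_box (@chain_extend n).
- rewrite -rev_rcons segs_rev all_rev all_map; apply: eq_all => s.
  by rewrite /good_run /= size_rev rev_sorted.
- by rewrite -size_eq0 size_rev size_eq0.
- by move=> a; rewrite mem_ints mem_rev -mem_ints; apply: lt_n.
Qed.

Lemma chain_lt_runs n R : R != [::] -> {in ints R, forall a, n < a} ->
  all (good_run ltn) (runs (Some n :: rcons R None)) = chain false R.
Proof.
by move=> R0 lt_n; rewrite -rcons_cons all_runs_rcons (@chain_extend n).
Qed.

Definition cyc_shape n c : Prop :=
  c = [:: Some n] \/ exists R, [/\ chain false R, odd (size R) &
      c = Some n :: rcons R None \/ c = [:: Some n, None & rev R]].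

Lemma uniq_min_lt n t : uniq (ints (Some n :: t)) ->
  {in ints (Some n :: t), forall a, n <= a} -> {in ints t, forall a, n < a}.
Proof.
move=> /= /andP[nt _] le_n a at_;
  rewrite ltn_neqAle le_n ?inE ?at_ ?orbT // andbT.
by apply: contraNneq nt => ->.
Qed.

Lemma cyc_shape_good A n c : entries_in A c -> uniq (ints c) ->
  {in ints c, forall a, n <= a} -> cyc_shape n c -> good A c.
Proof.
move=> eA u_c le_n sh.
have [t Ec] : exists t, c = Some n :: t.
  by case: sh => [->|[R [_ _ [->|->]]]]; eexists; reflexivity.
have lt_n : {in ints (behead c), forall a, n < a}.
  by rewrite Ec; apply: uniq_min_lt; rewrite -Ec.
rewrite /good (@canonical_rotE n) //; last by rewrite Ec mem_head.
rewrite Ec eqxx -Ec /odd_box_cycle /rev_odd_box_cycle /box_cycle_gen eA u_c /=.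
case: sh lt_n => [-> //|[R [cR oR ec]]] lt_n; apply/orP.
have R0 : R != [::] by case: R oR {cR ec}.
have lt_R : {in ints R, forall a, n < a}.
  move=> a aR; apply: lt_n; move: aR; rewrite !mem_ints.
  by case: ec => -> /=; rewrite ?mem_rcons ?inE ?mem_rev.
have cN : None \in c by case: ec => ->; rewrite !inE ?mem_rcons ?mem_head ?orbT.
have c1 : 1 < size c by case: ec => -> //=; rewrite size_rcons.
have oc : odd (size c) by case: ec => ->;
  rewrite /= ?size_rcons ?size_rev /= negbK.
have /chain_head[x [R1 ER]] := cR; have /chain_last[R2 [y ER']] := cR.
rewrite oc c1 cN /=; case: ec => -> ; [left | right]; apply/orP; right;
  apply/andP; split.
- apply: boxes_nonadj_path; rewrite rcons_path ER' last_rcons /= andbT -ER'.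
  by move: (chain_nonadj cR); rewrite ER.
- by rewrite chain_lt_runs.
- apply: boxes_nonadj_path.
  have: sorted nonadj (rev R).
    rewrite rev_sorted; apply: sub_sorted (chain_nonadj cR) => u v.
    by rewrite /nonadj orbC.
  by rewrite ER' rev_rcons.
- rewrite chain_gt_runs ?revK //; first by rewrite -size_eq0 size_rev size_eq0.
  by move=> a; rewrite mem_ints mem_rev -mem_ints; apply: lt_R.
Qed.

(** The minimum comes first in a run increasing clockwise, so a box precedes it; it comes last in a
    run increasing counterclockwise, so a box follows it. The canonical rotation starts at [n]. *)
Lemma good_shape A n c : good A c -> Some n \in c -> {in A, forall a, n <= a} ->
  [/\ entries_in A c, uniq (ints c) & cyc_shape n c].
Proof.
move=> gc nc le_n.
have [r rlt gr] : exists2 r : rel nat, r =2 ltn \/ r =2 (fun x y => y < x) &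
    box_cycle_gen r A c.
  case/andP: gc => _ /orP[gc|gc];
    [exists ltn | exists (fun x y => y < x)] => //;
  by [left | right].
have eA : entries_in A c by case/and4P: gr.
have u_c : uniq (ints c) by case/and4P: gr.
split => //.
have le_nc : {in ints c, forall a, n <= a}.
  by move=> a; rewrite mem_ints => /(entries_inP _ _ eA) /le_n.
case/andP: gc => + _; rewrite (canonical_rotE nc le_nc).
case: c nc eA u_c le_nc gr => [|b t] // _ eA u_c le_n' gr /= /eqP Eb; subst b.
have lt_n := uniq_min_lt u_c le_n'.
case/and4P: gr => _ _ oc /orP[|/and4P[_ cN _ ok]];
  first by case: t {lt_n oc u_c eA le_n'}; left.
right.
have [u [v [Euv uN]]] := box_split cN.
(* Cutting at the first box glues the end [v] to the start [u], so a letter at the end would share a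
   segment with the leading [n]. *)
have ok' : all (sorted r) (segs (v ++ u)).
  by rewrite -runs_cat // -Euv; apply: sub_all ok => s /andP[].
have good_runE : forall r', r =2 r' -> all (good_run r) =1 all (good_run r').
  by move=> r' rr' ss; apply: eq_all => s; rewrite /good_run (eq_sorted rr').
case: rlt => rlt.
- case/lastP: t {le_n' u_c eA} cN lt_n oc ok Euv => [|t [y|]] // cN lt_n oc ok
    Euv.
    have ltny : n < y by apply: lt_n; rewrite mem_ints mem_rcons mem_head.
    have [u' Eu] : exists u', u = Some n :: u'.
      by case: u Euv {uN ok'} => [|b u] // [<- _]; exists u.
    have [v' Ev] : exists v', v = rcons v' (Some y).
      move: (congr1 (last None) Euv); rewrite /= last_rcons last_cat /=.
      by case/lastP: v {Euv ok'} => [|v' z] //; rewrite last_rcons => <-;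
        exists v'.
    move: ok'; rewrite Eu Ev cat_rcons => /segs_adj; rewrite rlt /= => ltyn.
    by rewrite ltnNge ltnW in ltny.
  exists t; split; last by left.
    rewrite -(@chain_lt_runs n) -?(good_runE _ rlt) //.
      by case: t oc {cN lt_n ok Euv}.
    by move=> a at_; apply: lt_n;
      rewrite mem_ints mem_rcons inE -mem_ints at_ orbT.
  by move: oc; rewrite /= size_rcons /= negbK.
- case: t {le_n' u_c eA} cN lt_n oc ok Euv => [|[y|] t] // cN lt_n oc ok Euv.
    have ltny : n < y by apply: lt_n; rewrite mem_ints mem_head.
    have [u' Eu] : exists u', u = [:: Some n, Some y & u'].
      by case: u Euv {uN ok'} => [|b [|b' u]] // [<- <- _]; exists u.
    move: ok'; rewrite Eu => /segs_adj; rewrite rlt /= => ltyn.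
    by rewrite ltnNge ltnW in ltny.
  exists (rev t); rewrite size_rev revK; split; last by right.
    rewrite -(@chain_gt_runs n) -?(good_runE _ rlt) //.
    by case: t oc {cN lt_n ok Euv}.
  by move: oc; rewrite /= negbK.
Qed.

(** * Removing the cycle of the minimum *)

(** A box right after [n] marks the reverse cycle; otherwise [t] ends with the box that [take]
    drops. *)
Definition unstep (n : nat) (c p : word) : word :=
  match c with
  | [:: _] => Some n :: p
  | _ :: None :: v =>
      let R := rev v in
      if stuck R p then [:: Some n, None & R ++ p]
      else (tog R p).1 ++ [:: None, Some n & (tog R p).2]
  | _ :: t => take (size t).-1 t ++ [:: None, Some n & p]
  | [::] => [::]
  end.

(** In a box-permutation a letter directly before the minimum [n] would be smaller than [n]. So a
    box precedes [n] unless [n] is first, and [R] stops before that box, at [i.-1]. *)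
Definition step (n : nat) (w : word) : word * word :=
  let i := index (Some n) w in
  let p := drop i.+1 w in
  if i == 0 then
    if p is None :: x :: p' then ([:: Some n; None;
      x], p') else ([:: Some n], p)
  else
    let R := take i.-1 w in
    if odd (size R) then (Some n :: rcons R None, p)
    else ([:: Some n, None & rev (tog R p).1], (tog R p).2).

Lemma unstep1 n p : unstep n [:: Some n] p = Some n :: p.
Proof. by []. Qed.

Lemma unstep_lt n R p : chain false R ->
  unstep n (Some n :: rcons R None) p = R ++ [:: None, Some n & p].
Proof.
move=> /chain_head [a [t ->]].
by rewrite /unstep /= size_rcons -rcons_cons -cats1 (@take_size_cat _ _ (Some a
  :: t)).
Qed.

Lemma unstep_gt n R p : unstep n [:: Some n, None & rev R] p =
  if stuck R p then [:: Some n, None & R ++ p]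
  else (tog R p).1 ++ [:: None, Some n & (tog R p).2].
Proof. by rewrite /unstep revK. Qed.

Lemma step0 n p : bp p -> step n (Some n :: p) = ([:: Some n], p).
Proof. by case/bpP => [->|[a [t [-> _]]]]; rewrite /step /= eqxx. Qed.

Lemma step_box n x p : step n [:: Some n, None, x & p] = ([:: Some n; None;
  x], p).
Proof. by rewrite /step /= eqxx. Qed.

Lemma step_cat n R p : Some n \notin R ->
  step n (R ++ [:: None, Some n & p]) =
  if odd (size R) then (Some n :: rcons R None, p)
  else ([:: Some n, None & rev (tog R p).1], (tog R p).2).
Proof.
move=> nR; rewrite /step -cat_rcons index_pivot ?mem_rcons ?inE // size_rcons
  /=.
rewrite -cats1 -catA take_size_cat // catA -[(size R).+2]addn1 cats1.
have -> : drop ((size R).+1 + 1) (rcons R None ++ Some n :: p) = p.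
  by rewrite -cat_rcons drop_size_cat // !size_rcons addn1.
by [].
Qed.

Lemma chain_adj b u x y v : chain b (u ++ [:: Some x, Some y & v]) -> x < y.
Proof. by rewrite chain_segs => /andP[/segs_adj]. Qed.

Lemma nb_head_eq x y w e : bp w -> nb x w e = nb y w e.
Proof. by case/bpP => [->|[a [t [-> _]]]]. Qed.

(** Such a word begins and ends with integers, so none of its boxes sees the outer letters. *)
Lemma nb_chain_eq b x y w e e' : chain b w -> nb x w e = nb y w e'.
Proof.
move=> cw; have [a [t Ew]] := chain_head cw;
  have [t' [a' Ew']] := chain_last cw.
have -> : nb x w e = nb y w e by rewrite Ew.
by rewrite Ew' -cats1 !nb_cat.
Qed.

(** The box before [n] sees [n] and the last letter of [R], as does the box next to [n] in both
    cycles built from [R]; hence toggling must keep that letter. *)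
Lemma nb_cat_box n R p : chain false R -> bp p ->
  nb None (R ++ [:: None, Some n & p]) None =i
  seq_of_opt (nbr2 (last None R) (Some n)) ++ nb None R None ++ nb None p None.
Proof.
move=> cR bp_p X; rewrite nb_cat nb_box nb_Some (nb_head_eq _ None) //.
by rewrite [nb _ _ (head _ _)](nb_chain_eq _ None _ None cR) !mem_cat orbCA.
Qed.

Lemma nb_cyc_lt n R : chain false R ->
  nb (Some n) (rcons R None) (Some n) =i
  seq_of_opt (nbr2 (last None R) (Some n)) ++ nb None R None.
Proof.
move=> cR X; rewrite -cats1 nb_cat [nb _ [:: None] _]/= cats0.
rewrite [nb _ _ (head _ _)](nb_chain_eq _ None _ None cR) !mem_cat orbC.
by have [a [t ->]] := chain_head cR.
Qed.

Lemma nb_cyc_gt n R : chain false R ->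
  nb (Some n) (None :: rev R) (Some n) =i
  seq_of_opt (nbr2 (last None R) (Some n)) ++ nb None R None.
Proof.
move=> cR X; have [t [a ER]] := chain_last cR.
rewrite {1}ER rev_rcons nb_box -rev_rcons -ER mem_cat mem_nb_rev.
rewrite (nb_chain_eq _ None _ None cR) nbr2C {2}ER last_rcons.
by rewrite mem_cat.
Qed.

Lemma stepK n c p : uniq (ints (c ++ p)) -> {in ints (c ++ p), forall a, n <=
  a} ->
  cyc_shape n c -> bp p ->
  [/\ perm_eq (unstep n c p) (c ++ p), bp (unstep n c p),
      step n (unstep n c p) = (c, p) &
      nb None (unstep n c p) None =i
      nb (Some n) (behead c) (Some n) ++ nb None p None].
Proof.
move=> u_cp le_n sh bp_p.
have [t Ec] : exists t, c = Some n :: t.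
  by case: sh => [->|[R [_ _ [->|->]]]]; eexists; reflexivity.
have lt_n : {in ints (behead c ++ p), forall a, n < a}.
  by rewrite Ec; apply: uniq_min_lt; move: le_n u_cp; rewrite Ec.
have lt_p : {in ints p, forall a, n < a}.
  by move=> a; rewrite mem_ints => ap; rewrite lt_n // mem_ints mem_cat ap orbT.
case: sh => [{t Ec}Ec|[R [cR oR ec]]].
  rewrite Ec unstep1 step0 //; split => //.
    case/bpP: bp_p lt_p => [->|[b [t [-> cp]]]] lt_p; rewrite !chainE //.
    by rewrite cp andbT lt_p // mem_ints mem_head.
  by rewrite nb_Some (nb_head_eq _ None).
have R0 : R != [::] by case: R oR {cR ec}.
have lt_R : {in ints R, forall a, n < a}.
  move=> a aR; apply: lt_n; move: aR; rewrite !mem_ints mem_cat.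
  by case: ec => -> /=; rewrite ?mem_rcons ?inE ?mem_rev => ->.
have nR : Some n \notin R.
  by rewrite -mem_ints; apply/negP => /lt_R; rewrite ltnn.
have pmc : perm_eq (c ++ p) [:: Some n, None & R ++ p].
  by case: ec => ->; apply/permP => P;
    rewrite /= ?count_cat ?count_rev -?cats1 ?count_cat /=; lia.
have wfR : wf R p.
  rewrite /wf cR bp_p; move: u_cp.
  by rewrite (perm_uniq (perm_pmap _ pmc)) /= => /andP[].
have pm_box R' p' : perm_eq (R' ++ p') (R ++ p) ->
    perm_eq (R' ++ [:: None, Some n & p']) (c ++ p).
  move=> pm; apply/permP => P.
  by rewrite (permP pmc) /= -(permP pm) !count_cat /=; lia.
case: ec => Ec'; rewrite Ec'.
- rewrite unstep_lt // step_cat // oR -Ec'; split => //.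
  + exact: pm_box.
  + by rewrite /bp chain_cat_min // cR bp_p orbT.
  + by move=> X; rewrite nb_cat_box // mem_cat mem_cat mem_cat Ec' nb_cyc_lt //
      mem_cat orbA.
- rewrite unstep_gt; case: ifPn => st.
    (* Here [R] is one letter [a]. By distinctness the first letter of [p], if any, is larger, so
       [a] can start the segment after the box. *)
    case/andP: st => /eqP R1 npu.
    case: R R1 npu cR oR Ec' u_cp {pmc wfR pm_box R0 nR lt_R} => [|[a|] [|]] //
      _ npu cR oR Ec' u_cp.
    rewrite cat_cons step_box cat0s; split => //.
      case/bpP: bp_p lt_p npu u_cp => [->|[b [q [-> cp]]]] //.
      rewrite Ec' /pushable -leqNgt leq_eqVlt chainE => _ /predU1P[->|ab].
        by rewrite /= mem_head !andbF.
      by rewrite chainSNS chainSS ab cp.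
    move=> X; rewrite [rev _]/= [behead _]/= !(nb_box, nb_Some) mem_cat.
    by rewrite cats0 mem_cat (nb_head_eq _ None _ bp_p).
  case: (togP wfR st) => R1 p1 ->; rewrite /fst /snd.
  move=> wfR1 st1 tog1 odd1 pm1 last1 nb1; have /and3P[cR1 bp1 _] := wfR1.
  have lt1 a : Some a \in R1 ++ p1 -> n < a.
    rewrite (perm_mem pm1) mem_cat -!mem_ints => /orP[/lt_R|/lt_p] //.
  have nR1 : Some n \notin R1.
    by apply/negP => nR1; move: (lt1 n); rewrite mem_cat nR1 ltnn => /(_ isT).
  have lt_p1 : {in ints p1, forall a, n < a}.
    by move=> a; rewrite mem_ints => ap1; apply: lt1; rewrite mem_cat ap1 orbT.
  (* As [R] is odd, [R1] is even, so [step] takes the reverse branch and toggles back to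
     [(R, p)]. *)
  rewrite step_cat // odd1 oR tog1 -Ec'; split => //.
  + exact: pm_box.
  + rewrite /bp chain_cat_min // ?cR1 ?bp1 ?orbT //.
    by have [a [q ->]] := chain_head cR1.
  + move=> X; rewrite nb_cat_box // mem_cat nb1 last1 mem_cat Ec' [behead _]/=.
    by rewrite mem_cat nb_cyc_gt // !mem_cat orbA.
Qed.

Lemma step_surj n w : bp w -> Some n \in w -> uniq (ints w) ->
  {in ints w, forall a, n <= a} ->
  exists c p, [/\ cyc_shape n c, bp p, perm_eq w (c ++ p) & w = unstep n c p].
Proof.
move=> bp_w nw u_w le_n.
have cw : chain true w by case: w nw bp_w {u_w le_n}.
(* The part [u] before [n] is empty, ends with an integer (impossible by minimality), or ends with a
   box. *)
case/splitPr: w / nw bp_w u_w le_n cw => u q _ u_w le_n cw.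
case/lastP: u u_w le_n cw => [|u [y|]] u_w le_n cw.
- case: q u_w le_n cw => [|[a|] q] u_w le_n cw.
  + by exists [:: Some n], [::]; split => //; left.
  + exists [:: Some n], (Some a :: q); split => //; first by left.
    by move: cw; rewrite cat0s chainSS bp_cons => /andP[].
  + case: q u_w le_n cw => [|[a|] q] u_w le_n // cw.
    (* The letter [a] after the box is last or is followed by a larger letter. *)
    have bq : bp q /\ stuck [:: Some a] q.
      move: cw; rewrite cat0s chainSNS; case: q {u_w le_n} => [|[b|] q] //.
      rewrite chainSS => /and3P[_ ab cq].
      by rewrite bp_cons cq /stuck /pushable -leqNgt ltnW.
    exists [:: Some n; None; Some a], q; split=> //.
    * by right; exists [:: Some a]; split => //; right.
    * by case: bq.
    * by rewrite (@unstep_gt n [:: Some a]); case: bq => _ ->.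
- have := le_n y; move: cw; rewrite cat_rcons => /chain_adj yn.
  by rewrite mem_ints mem_cat !inE eqxx orbT leqNgt yn => /(_ isT).
- rewrite cat_rcons in u_w le_n cw *.
  have u0 : u != [::] by case: u cw {u_w le_n}.
  have pm : perm_eq (u ++ [:: None, Some n & q]) [:: Some n, None & u ++ q].
    by apply/permP => P; rewrite /= !count_cat /=; lia.
  have lt_n : {in ints (u ++ q), forall a, n < a}.
    have: uniq (ints [:: Some n, None & u ++ q]) by rewrite -(perm_uniq
      (perm_pmap _ pm)).
    move/uniq_min_lt => H; apply: H => a.
    by rewrite mem_ints -(perm_mem pm) -mem_ints; apply: le_n.
  have lt_q : {in ints q, forall a, n < a}.
    by move=> a; rewrite mem_ints => aq;
      rewrite lt_n // mem_ints mem_cat aq orbT.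
  move: cw; rewrite chain_cat_min // => /andP[cu bq].
  have [ou|eu] := boolP (odd (size u)).
  + exists (Some n :: rcons u None), q; split => //.
    * by right; exists u; split => //; left.
    * by apply/permP => P; rewrite -cats1 /= !count_cat /=; lia.
    * by rewrite unstep_lt.
  + have wfu : wf u q.
      rewrite /wf cu bq; move: u_w.
      by rewrite (perm_uniq (perm_pmap _ pm)) /= => /andP[].
    (* An even length is not 1, so the toggle applies; its image is odd, as the cycle requires. *)
    have nst : ~~ stuck u q by rewrite /stuck; case: eqP eu => // ->.
    case: (togP wfu nst) => R1 p1 _ wfR1 st1 tog1 odd1 pm1 _ _.
    have /and3P[cR1 bp1 _] := wfR1.
    exists [:: Some n, None & rev R1], p1; split => //.
    * by right; exists R1; rewrite odd1; split => //; right.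
    * apply: (perm_trans pm); rewrite /= !perm_cons perm_sym.
      by apply: perm_trans pm1; rewrite perm_cat2r perm_rev.
    * by rewrite unstep_gt (negbTE st1) tog1.
Qed.

(** * The bijection *)

Lemma ints_cat u v : ints (u ++ v) = ints u ++ ints v.
Proof. exact: pmap_cat. Qed.

Definition rest (A : {fset nat}) (c : word) : {fset nat} :=
  [fset a in A | Some a \notin c].

Lemma in_rest A c a : (a \in rest A c) = (a \in A) && (Some a \notin c).
Proof. by rewrite !inE. Qed.

Lemma perm_rest (A : {fset nat}) c p : entries_in A c -> uniq (ints c) ->
  perm_eq (ints (c ++ p)) A = perm_eq (ints p) (rest A c).
Proof.
move=> /entries_inP eA u_c; apply/idP/idP => pA.
  have u_cp : uniq (ints (c ++ p)) by rewrite (perm_uniq pA) fset_uniq.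
  apply: uniq_perm => [||a]; rewrite ?fset_uniq //.
    by move: u_cp; rewrite ints_cat cat_uniq => /and3P[].
  rewrite in_rest -(perm_mem pA) !mem_ints mem_cat.
  case: (boolP (Some a \in c)) => //= ac; rewrite ?andbT //.
  apply/negbTE; move: u_cp; rewrite ints_cat cat_uniq => /and3P[_ /hasPn H _].
  by apply/negP => ap; have := H a; rewrite !mem_ints ac => /(_ ap).
have u_p : uniq (ints p) by rewrite (perm_uniq pA) fset_uniq.
have mp a : (Some a \in p) = (a \in A) && (Some a \notin c).
  by rewrite -mem_ints (perm_mem pA) in_rest.
apply: uniq_perm => [||a]; rewrite ?fset_uniq //.
  rewrite ints_cat cat_uniq u_c u_p andbT /=.
  by apply/hasPn => a; rewrite /= !mem_ints mp => /andP[].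
rewrite mem_ints mem_cat mp; case: (boolP (Some a \in c)) => [/eA ->|] //.
by rewrite andbT.
Qed.

Lemma unstepP (A : {fset nat}) n c p : {in A, forall a, n <= a} -> good A c ->
  Some n \in c -> is_BP (rest A c) p ->
  [/\ is_BP A (unstep n c p), step n (unstep n c p) = (c, p) &
      forall X, (X \in box_nbrs (unstep n c p)) =
                (X \in cyc_box_nbrs c) || (X \in box_nbrs p)].
Proof.
move=> le_n gc nc; rewrite is_BPE => /andP[pA bp_p].
have [eA u_c sh] := good_shape gc nc le_n.
rewrite -perm_rest // in pA.
have u_cp : uniq (ints (c ++ p)) by rewrite (perm_uniq pA) fset_uniq.
have le_cp : {in ints (c ++ p), forall a, n <= a}.
  by move=> a; rewrite (perm_mem pA); apply: le_n.
have [pm bpw stw nbw] := stepK u_cp le_cp sh bp_p.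
split=> // [|X]; first by rewrite is_BPE bpw (perm_trans (perm_pmap _ pm)).
rewrite !mem_box_nbrs nbw mem_cat.
have [t ->] : exists t, c = Some n :: t.
  by case: sh => [->|[R [_ _ [->|->]]]]; eexists; reflexivity.
by rewrite cyc_box_nbrsE.
Qed.

Lemma unstep_surj (A : {fset nat}) n w : {in A, forall a, n <= a} -> n \in A ->
  is_BP A w ->
  exists c p, [/\ good A c, Some n \in c, is_BP (rest A c) p & w = unstep n c
    p].
Proof.
move=> le_n nA; rewrite is_BPE => /andP[pA bp_w].
have nw : Some n \in w by rewrite -mem_ints (perm_mem pA).
have u_w : uniq (ints w) by rewrite (perm_uniq pA) fset_uniq.
have le_w : {in ints w, forall a, n <= a}.
  by move=> a; rewrite (perm_mem pA); apply: le_n.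
have [c [p [sh bp_p pm ew]]] := step_surj bp_w nw u_w le_w.
have pmi : perm_eq (ints w) (ints (c ++ p)) := perm_pmap _ pm.
have mem_c a : Some a \in c -> a \in ints w.
  by move=> ac; rewrite (perm_mem pmi) mem_ints mem_cat ac.
have u_c : uniq (ints c).
  by move: u_w; rewrite (perm_uniq pmi) ints_cat cat_uniq => /and3P[].
have eA : entries_in A c by apply/entries_inP => a /mem_c;
  rewrite (perm_mem pA).
exists c, p; split=> //.
- apply: cyc_shape_good (sh) => // a; rewrite mem_ints => /mem_c; exact: le_w.
- by case: sh => [->|[R [_ _ [->|->]]]]; rewrite mem_head.
- by rewrite is_BPE bp_p andbT -perm_rest // -(permPl pmi).
Qed.

(** * Adding and removing one cycle of a cyclic box-permutation *)

Lemma good_entries A c : good A c -> entries_in A c.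
Proof. by case/andP => _ /orP[]/and4P[]. Qed.

Lemma good_change A B c : good A c -> entries_in B c -> good B c.
Proof.
rewrite /good /odd_box_cycle /rev_odd_box_cycle /box_cycle_gen => gc ->.
by case/andP: gc => -> /orP[]/andP[_ ->]; rewrite ?orbT.
Qed.

(** Of two adjacent entries at most one is a box. This excludes cycles without letters over the
    empty set. *)
Lemma good_has_int A c : good A c -> exists a, Some a \in c.
Proof.
case/andP => _ gc.
have : (if c is [:: Some _] then true else false) ||
    (1 < size c) && boxes_nonadj c.
  by case/orP: gc => /and4P[_ _ _ /orP[->|/and4P[-> _ -> _]]]; rewrite ?orbT.
case/orP => [|/andP[c1 /allP/(_ 0) /=]].
  by case: c {gc} => [|[a|] [|]] // _; exists a; rewrite mem_head.
rewrite mem_iota add0n (ltnW c1) modn_small // => /(_ isT).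
have ex i : i < size c -> nth None c i != None -> exists a, Some a \in c.
  by move=> ic; case E : (nth None c i) => [a|] // _; exists a;
    rewrite -E mem_nth.
by case/orP; apply: ex => //; apply: ltnW.
Qed.

Lemma count_fsetU1 (P : pred word) c (S : {fset word}) : c \notin S ->
  count P (c |` S) = (P c + count P S)%N.
Proof.
move=> cS; rewrite -[RHS]/(count P (c :: S)); apply/permP/uniq_perm.
- exact: fset_uniq.
- by rewrite /= cS fset_uniq.
- by move=> d; rewrite !inE.
Qed.

Lemma is_cBP_good A S c : is_cBP A S -> c \in S -> good A c.
Proof. by case/andP => /allP H _ /H. Qed.

(** Each letter lies in exactly one cycle, so the other cycles avoid the letters of [c] and cover
    the rest. *)
Lemma is_cBP_fsetU1 A c S : good A c -> c \notin S ->
  is_cBP A (c |` S) = is_cBP (rest A c) S.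
Proof.
move=> gc cS; apply/andP/andP => -[/allP /= gS /allP cA]; split;
  apply/allP => /=.
- move=> d dS; have gd : good A d by apply: gS; rewrite !inE dS orbT.
  apply: (good_change gd); apply/entries_inP => a ad.
  have aA : a \in A by apply: (entries_inP _ _ (good_entries gd)).
  rewrite in_rest aA /=; apply/negP => ac.
  have := cA a aA; rewrite count_fsetU1 // ac add1n eqSS => /eqP c0.
  have : has (fun c => Some a \in c) S by apply/hasP; exists d.
  by rewrite has_count c0.
- move=> a; rewrite in_rest => /andP[aA ac].
  by have := cA a aA; rewrite count_fsetU1 // (negbTE ac).
- move=> d; rewrite !inE => /predU1P[-> //|/gS gd].
  apply: (good_change gd); apply/entries_inP => a.
  by move=> /(entries_inP _ _ (good_entries gd)); rewrite in_rest => /andP[].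
- move=> a aA; rewrite count_fsetU1 //.
  have [ac|ac] := boolP (Some a \in c); last by apply: cA; rewrite in_rest aA.
  rewrite add1n eqSS -leqn0 leqNgt -has_count; apply/hasPn => d dS.
  apply/negP => ad; have := entries_inP _ _ (good_entries (gS d dS)) a ad.
  by rewrite in_rest ac andbF.
Qed.

Lemma cbox_nbrsP (S : {fset word}) (X : {fset nat}) :
  reflect (exists2 c, c \in S & X \in cyc_box_nbrs c) (X \in cbox_nbrs S).
Proof. by rewrite !inE; apply: flatten_mapP. Qed.

Lemma mem_cbox_fsetU1 c (S : {fset word}) (X : {fset nat}) :
  (X \in cbox_nbrs (c |` S)) = (X \in cyc_box_nbrs c) || (X \in cbox_nbrs S).
Proof.
apply/cbox_nbrsP/orP => [[d]|[Xc|/cbox_nbrsP[d dS Xd]]].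
- by rewrite in_fset1U => /predU1P[->|dS] Xd; [left | right; apply/cbox_nbrsP;
    exists d].
- by exists c; rewrite ?fset1U1.
- by exists d; rewrite ?inE ?dS ?orbT.
Qed.

(** * Recursion on the least letter *)

Definition fmin (A : {fset nat}) : nat := head 0 (sort leq A).

Lemma fminP (A : {fset nat}) : A != fset0 -> fmin A \in A /\ {in A, forall a,
  fmin A <= a}.
Proof.
move=> A0; have mS : sort leq A =i A by move=> a; rewrite mem_sort.
have := sort_sorted leq_total A; move: mS; rewrite /fmin.
case: (sort leq A) => [|b s] mS /=.
  by case/fset0Pn: A0 => a; rewrite -mS.
rewrite path_sortedE; last exact: leq_trans.
move=> /andP[/allP bs _]; split; first by rewrite -mS mem_head.
by move=> a; rewrite -mS inE => /predU1P[->|/bs].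
Qed.

(** The counter [k] makes the recursion structural; the size of [A] is enough, since each round
    removes at least the minimum. *)
Fixpoint cyc_of (k : nat) (A : {fset nat}) (w : word) : {fset word} :=
  if (k, w) is (k'.+1, _ :: _)
  then let: (c, p) := step (fmin A) w in c |` cyc_of k' (rest A c) p
  else fset0.

Lemma is_BP_nil A w : is_BP A w -> (w == [::]) = (A == fset0).
Proof.
rewrite is_BPE => /andP[pA bp_w]; apply/eqP/eqP => [w0|A0].
  by apply/fsetP => a; rewrite -(perm_mem pA) w0 inE.
have wa a : Some a \notin w by rewrite -mem_ints (perm_mem pA) A0 inE.
by case/bpP: bp_w => // -[a [t [Ew _]]]; have := wa a; rewrite Ew mem_head.
Qed.

Lemma is_cBP_fset0 S : is_cBP fset0 S = (S == fset0).
Proof.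
apply/idP/eqP => [cS|->]; last first.
  by apply/andP; split; apply/allP => x; rewrite inE.
apply/eqP; apply: contraT => /fset0Pn[c /(is_cBP_good cS) gc].
have [a ac] := good_has_int gc.
by have := entries_inP _ _ (good_entries gc) a ac; rewrite inE.
Qed.

Definition preserving_bijection A (psi : word -> {fset word}) : Prop :=
  [/\ (forall w, is_BP A w -> is_cBP A (psi w)),
      (forall w1 w2, is_BP A w1 -> is_BP A w2 -> psi w1 = psi w2 -> w1 = w2),
      (forall S, is_cBP A S -> exists2 w, is_BP A w & psi w = S) &
      (forall w, is_BP A w -> cbox_nbrs (psi w) = box_nbrs w)].

Lemma cyc_of0 k : preserving_bijection fset0 (cyc_of k fset0).
Proof.
have w0 w : is_BP fset0 w -> w = [::].
  by move=> /is_BP_nil; rewrite eqxx => /eqP.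
have E0 : cyc_of k fset0 [::] = fset0 by case: k.
split=> [w /w0->|w1 w2 /w0-> /w0-> //|S|w /w0->].
- by rewrite E0 is_cBP_fset0.
- by rewrite is_cBP_fset0 => /eqP ->; exists [::] => //.
- rewrite E0; apply/fsetP => X; rewrite [RHS]mem_box_nbrs.
  by apply/negbTE/cbox_nbrsP => -[c]; rewrite inE.
Qed.

Lemma cyc_ofP k (A : {fset nat}) : #|` A| <= k ->
  preserving_bijection A (cyc_of k A).
Proof.
elim: k A => [|k IH] A leAk;
  (have [->|A0] := eqVneq A fset0; first exact: cyc_of0).
  by move: leAk; rewrite leqn0 cardfs_eq0 (negbTE A0).
have [nA le_n] := fminP A0; set n := fmin A in nA le_n.
have rest_lt c : Some n \in c -> #|` rest A c| <= k.
  move=> nc; rewrite -ltnS (leq_trans _ leAk) // fproper_ltn_card //.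
  rewrite fproperEneq; apply/andP; split.
    by apply/eqP => /fsetP /(_ n); rewrite in_rest nc nA.
  by apply/fsubsetP => a; rewrite in_rest => /andP[].
(* [step] inverts [unstep], and the word is nonempty because [A] is, so the recursion unfolds
   once. *)
have cycE c p : good A c -> Some n \in c -> is_BP (rest A c) p ->
    cyc_of k.+1 A (unstep n c p) = c |` cyc_of k (rest A c) p.
  move=> gc nc bp_p; have [bw stw _] := unstepP le_n gc nc bp_p.
  have := is_BP_nil bw; rewrite (negbTE A0).
  by move: stw; case: (unstep n c p) => //= x w ->.
(* The cycles in [S] avoid the letters of [d], among them [n]. *)
have notin c d S : Some n \in c -> is_cBP (rest A d) S -> Some n \in d -> c
  \notin S.
  move=> nc cS nd; apply/negP => /(is_cBP_good cS) /good_entries /entries_inP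
    /(_ n nc).
  by rewrite in_rest nd andbF.
split.
- move=> w bw; have [c [p [gc nc bp_p ->]]] := unstep_surj le_n nA bw.
  have [IH1 _ _ _] := IH _ (rest_lt c nc).
  by rewrite cycE // is_cBP_fsetU1 ?IH1 // (notin c c) // IH1.
- move=> w1 w2 bw1 bw2.
  have [c1 [p1 [gc1 nc1 bp_p1 ->]]] := unstep_surj le_n nA bw1.
  have [c2 [p2 [gc2 nc2 bp_p2 ->]]] := unstep_surj le_n nA bw2.
  rewrite !cycE // => E.
  have [IH1 _ _ _] := IH _ (rest_lt c1 nc1).
  have [IH1' IH2 _ _] := IH _ (rest_lt c2 nc2).
  (* On the right-hand side [c2] is the only cycle through [n], and [c1] contains [n]. *)
  have Ec : c1 = c2.
    have : c1 \in c2 |` cyc_of k (rest A c2) p2 by rewrite -E fset1U1.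
    by rewrite !inE (negbTE (notin _ _ _ nc1 (IH1' _ bp_p2) nc2)) orbF => /eqP.
  move: E bp_p1 gc1 nc1 IH1; rewrite {}Ec => E bp_p1 _ _ _.
  congr unstep; apply: IH2 => //.
  move: (congr1 (fun S => S `\ c2) E).
  by rewrite !fsetU1K // (notin c2 c2) // IH1'.
- move=> S cS.
  (* The letter [n] is counted once, so some cycle of [S] contains it; that cycle is split off. *)
  have : has (fun c => Some n \in c) S.
    by rewrite has_count; case/andP: (cS) => _ /allP /(_ n nA) /eqP ->.
  case/hasP => c cinS /= nc; have gc := is_cBP_good cS cinS.
  have [_ _ IH3 _] := IH _ (rest_lt c nc).
  have cS' : is_cBP (rest A c) (S `\ c).
    by rewrite -is_cBP_fsetU1 ?fsetD1K // !inE eqxx.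
  have [p bp_p ES] := IH3 _ cS'.
  have [bw _ _] := unstepP le_n gc nc bp_p; have := cycE c p gc nc bp_p.
  by rewrite ES fsetD1K // => Ew; exists (unstep n c p).
- move=> w bw; have [c [p [gc nc bp_p ->]]] := unstep_surj le_n nA bw.
  have [_ _ _ IH4] := IH _ (rest_lt c nc).
  apply/fsetP => X; rewrite cycE // mem_cbox_fsetU1 IH4 //.
  by have [_ _ ->] := unstepP le_n gc nc bp_p.
Qed.

Theorem theorem2p1 (A : {fset nat}) (hA : forall a, a \in A -> 0 < a) :
  exists psi : seq (option nat) -> {fset seq (option nat)},
    [/\ (forall w, is_BP A w -> is_cBP A (psi w)),
        (forall w1 w2, is_BP A w1 -> is_BP A w2 -> psi w1 = psi w2 -> w1 = w2),
        (forall S, is_cBP A S -> exists2 w, is_BP A w & psi w = S) &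
        (forall w, is_BP A w -> cbox_nbrs (psi w) = box_nbrs w)].
Proof. by exists (cyc_of #|` A| A); apply: cyc_ofP. Qed.
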